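(* There exist uncountably many $\pmb{\alpha} = (\alpha_1,\alpha_2)\in \mathbb{R}^2$ such that all of the following hold: (1) $1,\alpha_1,\alpha_2$ are linearly independent over $\mathbb{Z}$; (2) $\inf_\nu\frac {\xi_{\nu+1}}{\xi_\nu} >0$, where $\xi_1>\xi_2>\dots$ is the sequence of approximation errors of the best simultaneous approximations to $\pmb\alpha$; (3) $\pmb{\alpha}$ is not badly approximable.
   Context: For real $x$, $\|x\|=\min_{a\in\mathbb{Z}}|x-a|$. $\pmb\alpha\in\mathbb{R}^2$ is badly approximable if $\inf_{q\ge1,\,q\in\mathbb{Z}} q^{1/2}\max(\|q\alpha_1\|,\|q\alpha_2\|)>0$. Best simultaneous approximations: $q_1<q_2<\dots$ is the increasing sequence of all positive integers $q_\nu$ such that $\max_{j=1,2}\|q_\nu\alpha_j\|<\max_{j=1,2}\|q\alpha_j\|$ for all positive integers $q<q_\nu$ (so $q_1=1$), and $\xi_\nu=\max_{j=1,2}\|q_\nu\alpha_j\|$. *)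

(* Defs.v *)
From HB Require Import structures.
From mathcomp Require Import all_boot all_order all_algebra.
From mathcomp Require Import all_classical all_reals.
Set Implicit Arguments.
Unset Strict Implicit.
Unset Printing Implicit Defensive.
Import Order.TTheory GRing.Theory Num.Theory.
Local Open Scope classical_set_scope.
Local Open Scope ring_scope.

(* The infimum is attained, so this is the minimum over the integers. *)
Definition dist_int (R : realType) (x : R) : R :=
  inf [set `|x - a%:~R| | a in [set: int]].

Definition approx_err (R : realType) (alpha : R * R) (q : nat) : R :=
  Num.max (dist_int (q%:R * alpha.1)) (dist_int (q%:R * alpha.2)).

Definition badly_approximable (R : realType) (alpha : R * R) : Prop :=
  0 < inf [set Num.sqrt q%:R * approx_err alpha q | q in [set q : nat | (1 <= q)%N]].

Definition Zindependent1 (R : realType) (alpha : R * R) : Prop :=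
  forall a b c : int,
    a%:~R + b%:~R * alpha.1 + c%:~R * alpha.2 = 0 -> [/\ a = 0, b = 0 & c = 0].

Definition best_approx (R : realType) (alpha : R * R) (q : nat) : Prop :=
  (1 <= q)%N /\
  forall p : nat, (1 <= p < q)%N -> approx_err alpha q < approx_err alpha p.

(* Indices are shifted by one: [q 0] is q_1 = 1.  Such a [q] is unique when it
   exists; it exists exactly when there are infinitely many best
   approximations, i.e. when alpha is not in Q^2. *)
Definition best_approx_seq (R : realType) (alpha : R * R) (q : nat -> nat) : Prop :=
  {homo q : m n / (m < n)%N} /\ range q = [set p | best_approx alpha p].

(* Main.v *)
Require Import Defs.
From HB Require Import structures.
From mathcomp Require Import all_boot all_order all_algebra.
From mathcomp Require Import all_classical all_reals.
From mathcomp Require Import ring lra zify.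
Set Implicit Arguments.
Unset Strict Implicit.
Unset Printing Implicit Defensive.
Import Order.TTheory GRing.Theory Num.Theory.
Local Open Scope classical_set_scope.
Local Open Scope ring_scope.

(** Inside a rational line a point can be as badly approximable as the golden
    ratio phi is in dimension one.  Take a basis v0, v1 of a plane lattice
    Lambda in Z^3 (triples (q, p1, p2)) and the point alpha whose homogeneous
    direction (1, alpha) is v0 + phi v1 ([gold]).  The error vectors
    q alpha - p of the Fibonacci combinations v_(j+1) = v_j + v_(j-1) shrink by
    exactly 1 / phi at each step, integer points of Lambda do no better
    ([gold_on]), and those outside Lambda have error at least 1 / (2 H) for a
    constant H, the covolume of Lambda seen from alpha ([gold_off]).  Hence
    consecutive best approximations far out have a bounded ratio of errors,
    while q * error^2 tends to 0 along the v_j, as happens on every rational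
    line.

    A point on a rational line has 1, alpha_1, alpha_2 dependent, so the line has
    to be left, again and again, without spoiling the ratio.  The turn
    ([gold_turn]) goes as follows.  Let v = v_k be far out, with error eps, and
    let u complete the basis of Lambda to a basis of Z^3.  Replace the
    direction by v + phi w where w = u + m v.  The error of w at the rational point
    given by v does not depend on m, so m is free to make the new error of v
    comparable to eps.  The new plane lattice <v, w> has covolume
    at most of order 1 / eps, provided that u was chosen with error of order
    1 / H ([gold_reduce]); so the points outside it have errors at least of
    order eps.  The sequence v_0, ..., v_k, w, v + w, ... then has
    consecutive errors of bounded ratio and nothing much better in between, with
    a bound (64) that does not depend on the lattices.

    Call a point [tame] when it is golden on some rational line and satisfies
    the ratio condition for every q.  Every tame point is a limit of tame points
    off its own line ([tame_step]).  The ratio condition at a given q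
    ([steady]), the existence of q with sqrt q * error < 1 / n, being off a
    given rational line, and being different from a given point are open
    conditions, and each can be reached from a tame point by an arbitrarily
    small move to another tame point.  So, as in the Baire category theorem
    ([dense_open_intersection]), some point satisfies countably many
    of them at once, in particular one that escapes any given enumeration. *)

(** * The golden ratio *)

Definition phi (R : realType) : R := (1 + Num.sqrt 5) / 2.

Lemma phi_sqr (R : realType) : phi R * phi R = phi R + 1.
Proof.
have : Num.sqrt (5 : R) ^+ 2 = 5 by rewrite sqr_sqrtr.
rewrite /phi; set s := Num.sqrt _ => hs; lra.
Qed.

Lemma phi_bounds (R : realType) : 8 / 5 < phi R /\ phi R < 17 / 10.
Proof.
have s0 : 0 <= Num.sqrt (5 : R) by exact: sqrtr_ge0.
have hs : Num.sqrt (5 : R) ^+ 2 = 5 by rewrite sqr_sqrtr.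
rewrite /phi; move: s0 hs; set s := Num.sqrt _ => s0 hs.
have h1 : 11 / 5 < s by rewrite ltNge; apply/negP => h; nra.
have h2 : s < 12 / 5 by rewrite ltNge; apply/negP => h; nra.
by split; lra.
Qed.

Lemma phi_gt0 (R : realType) : 0 < phi R.
Proof. by have := phi_bounds R; lra. Qed.

(** * Errors of integer points *)

(** Integer points (q, p1, p2), where p1 / q and p2 / q approximate alpha. *)
Definition vec := (int * int * int)%type.
Definition den (x : vec) : int := x.1.1.

Definition det3 (x y z : vec) : int :=
  x.1.1 * (y.1.2 * z.2 - y.2 * z.1.2) - x.1.2 * (y.1.1 * z.2 - y.2 * z.1.1)
  + x.2 * (y.1.1 * z.1.2 - y.1.2 * z.1.1).

(** [err1] and [err2] are the coordinates of the error vector q alpha - p, a linear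
    function of (q, p1, p2) that vanishes on the direction (1, alpha). *)
Definition err1 (R : realType) (alpha : R * R) (x : vec) : R :=
  (den x)%:~R * alpha.1 - x.1.2%:~R.
Definition err2 (R : realType) (alpha : R * R) (x : vec) : R :=
  (den x)%:~R * alpha.2 - x.2%:~R.
Definition res (R : realType) (alpha : R * R) (x : vec) : R :=
  Num.max `|err1 alpha x| `|err2 alpha x|.
Definition dist (R : realType) (alpha beta : R * R) : R :=
  Num.max `|beta.1 - alpha.1| `|beta.2 - alpha.2|.

Lemma dist_ge0 (R : realType) (alpha beta : R * R) : 0 <= dist alpha beta.
Proof. by rewrite /dist le_max normr_ge0. Qed.

Lemma coord_le_dist (R : realType) (alpha beta : R * R) :
  `|beta.1 - alpha.1| <= dist alpha beta /\ `|beta.2 - alpha.2| <= dist alpha beta.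
Proof. by split; rewrite /dist le_max lexx ?orbT. Qed.

Lemma err1D (R : realType) (alpha : R * R) (x y : vec) :
  err1 alpha (x + y) = err1 alpha x + err1 alpha y.
Proof. rewrite /err1 /den /= !intrD; ring. Qed.

Lemma err2D (R : realType) (alpha : R * R) (x y : vec) :
  err2 alpha (x + y) = err2 alpha x + err2 alpha y.
Proof. rewrite /err2 /den /= !intrD; ring. Qed.

Definition zscale (m : int) (x : vec) : vec := (m * x.1.1, m * x.1.2, m * x.2).

Lemma err1Z (R : realType) (alpha : R * R) (m : int) (x : vec) :
  err1 alpha (zscale m x) = m%:~R * err1 alpha x.
Proof. rewrite /err1 /den /= !intrM; ring. Qed.

Lemma err2Z (R : realType) (alpha : R * R) (m : int) (x : vec) :
  err2 alpha (zscale m x) = m%:~R * err2 alpha x.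
Proof. rewrite /err2 /den /= !intrM; ring. Qed.

Lemma err1_le_res (R : realType) (alpha : R * R) (x : vec) : `|err1 alpha x| <= res alpha x.
Proof. by rewrite /res le_max lexx. Qed.
Lemma err2_le_res (R : realType) (alpha : R * R) (x : vec) : `|err2 alpha x| <= res alpha x.
Proof. by rewrite /res le_max lexx orbT. Qed.
Lemma res_ge0 (R : realType) (alpha : R * R) (x : vec) : 0 <= res alpha x.
Proof. exact: le_trans (err1_le_res _ _). Qed.

Lemma res_scale (R : realType) (alpha beta : R * R) (x y : vec) (c : R) :
  err1 alpha x = c * err1 beta y -> err2 alpha x = c * err2 beta y ->
  res alpha x = `|c| * res beta y.
Proof. by rewrite /res => -> ->; rewrite !normrM maxr_pMr. Qed.

(** The error of an integer point is Lipschitz in alpha with constant its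
    denominator; this makes every condition on finitely many q open. *)
Lemma res_perturb (R : realType) (alpha beta : R * R) (x : vec) : 0 <= den x ->
  res beta x <= res alpha x + (den x)%:~R * dist alpha beta.
Proof.
move=> x0; have x0' : 0 <= (den x)%:~R :> R by rewrite ler0z.
have a1 := err1_le_res alpha x; have a2 := err2_le_res alpha x.
have [d1 d2] := coord_le_dist alpha beta.
rewrite {1}/res ge_max; apply/andP; split.
- have -> : err1 beta x = err1 alpha x + (den x)%:~R * (beta.1 - alpha.1).
    by rewrite /err1; ring.
  apply: le_trans (ler_normD _ _) _; apply: lerD => //.
  by rewrite normrM (ger0_norm x0') ler_wpM2l.
- have -> : err2 beta x = err2 alpha x + (den x)%:~R * (beta.2 - alpha.2).
    by rewrite /err2; ring.
  apply: le_trans (ler_normD _ _) _; apply: lerD => //.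
  by rewrite normrM (ger0_norm x0') ler_wpM2l.
Qed.

(** Two points from which the same x has small errors are both close to p / q. *)
Lemma dist_le_res (R : realType) (alpha beta : R * R) (x : vec) : 0 <= den x ->
  (den x)%:~R * dist alpha beta <= res beta x + res alpha x.
Proof.
move=> x0; have x0' : 0 <= (den x)%:~R :> R by rewrite ler0z.
have b1 := err1_le_res beta x; have b2 := err2_le_res beta x.
have c1 := err1_le_res alpha x; have c2 := err2_le_res alpha x.
rewrite /dist maxr_pMr // -[X in X * `|_|](ger0_norm x0') -[X in _ (X * _)](ger0_norm x0').
rewrite -!normrM ge_max; apply/andP; split.
  have -> : (den x)%:~R * (beta.1 - alpha.1) = err1 beta x - err1 alpha x.
    by rewrite /err1; ring.
  by apply: le_trans (ler_normB _ _) (lerD _ _).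
have -> : (den x)%:~R * (beta.2 - alpha.2) = err2 beta x - err2 alpha x.
  by rewrite /err2; ring.
by apply: le_trans (ler_normB _ _) (lerD _ _).
Qed.

Lemma dist_sym (R : realType) (alpha beta : R * R) : dist alpha beta = dist beta alpha.
Proof. by rewrite /dist distrC [X in Num.max _ X]distrC. Qed.

Lemma dist_int_le (R : realType) (x : R) (a : int) : dist_int x <= `|x - a%:~R|.
Proof. by apply: ge_inf; [exists 0 => _ [b _ <-] | exists a]. Qed.

(** Rounding to the nearest integer attains the infimum. *)
Lemma dist_int_attained (R : realType) (x : R) : exists a : int, dist_int x = `|x - a%:~R|.
Proof.
pose a := Num.floor (x + 1 / 2); exists a.
have h1 : a%:~R <= x + 1 / 2 by exact: floor_le.
have h2 : x + 1 / 2 < (a + 1)%:~R by exact: floorD1_gt.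
rewrite intrD in h2.
apply/le_anti; rewrite dist_int_le /=.
apply: lb_le_inf; first by exists `|x - 0%:~R|; exists 0.
move=> _ [b _ <-].
have hx : `|x - a%:~R| <= 1 / 2 by rewrite ler_norml; apply/andP; split; lra.
have [->|ne] := eqVneq a b; first exact: lexx.
apply: le_trans hx _.
have : (1 : R) <= `|(a - b)%:~R|.
  by rewrite -intr_norm ler1z -gtz0_ge1 normr_gt0 subr_eq0.
rewrite intrB => h.
have := ler_normD (x - b%:~R) (a%:~R - x).
rewrite [X in `|X| <= _ -> _](_ : _ = a%:~R - b%:~R); last by ring.
have hx' : `|a%:~R - x| <= 1 / 2 by rewrite ler_norml; apply/andP; split; lra.
lra.
Qed.

Lemma approx_err_le_res (R : realType) (alpha : R * R) (x : vec) (p : nat) :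
  den x = p -> approx_err alpha p <= res alpha x.
Proof.
rewrite /res /err1 /err2 => ->; rewrite -!pmulrn.
by rewrite /approx_err ge_max !le_max !dist_int_le /= orbT.
Qed.

(** With [approx_err_le_res], this trades the infima in [approx_err] for integer
    points. *)
Lemma approx_err_attained (R : realType) (alpha : R * R) (p : nat) :
  exists2 x : vec, den x = p & approx_err alpha p = res alpha x.
Proof.
have [a ha] := dist_int_attained (p%:R * alpha.1).
have [b hb] := dist_int_attained (p%:R * alpha.2).
exists (Posz p, a, b) => //.
by rewrite /approx_err ha hb /res /err1 /err2 /den /= -!pmulrn.
Qed.

Lemma approx_err_ge0 (R : realType) (alpha : R * R) (p : nat) : 0 <= approx_err alpha p.
Proof. by have [x _ ->] := approx_err_attained alpha p; exact: res_ge0. Qed.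

Lemma approx_err_perturb (R : realType) (alpha beta : R * R) (p : nat) :
  approx_err beta p <= approx_err alpha p + p%:R * dist alpha beta.
Proof.
have [x xp ->] := approx_err_attained alpha p.
apply: le_trans (approx_err_le_res beta xp) _.
by have := @res_perturb R alpha beta x; rewrite xp -pmulrn; apply.
Qed.

(** * Ratios of consecutive errors *)

(** The next record after q (at most q') is not better than the record up to q
    (at most the error of r) by more than a factor 64.  Naming q' and r, instead
    of the best approximations, leaves finitely many strict inequalities between
    errors at fixed integers: an open condition on alpha. *)
Definition steady (R : realType) (alpha : R * R) (q : nat) : Prop :=
  exists q' r : nat, [/\ (0 < q')%N, (0 < r <= q)%N,
    forall p, (0 < p <= q')%N -> approx_err alpha r < 64 * approx_err alpha p &
    forall p, (0 < p <= q)%N -> approx_err alpha q' < approx_err alpha p].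

(** The successor of a best approximation q is the least q' that beats every
    p <= q; [steady] provides such a q', hence infinitely many best
    approximations, and bounds the error of the successor from below. *)
Lemma steady_ratio (R : realType) (alpha : R * R) :
  (forall q, (0 < q)%N -> steady alpha q) ->
  exists q : nat -> nat, best_approx_seq alpha q /\
    0 < inf [set approx_err alpha (q nu.+1) / approx_err alpha (q nu)
            | nu in [set: nat]].
Proof.
move=> st; pose e := approx_err alpha.
pose better q q' := (0 < q')%N /\ forall p, (0 < p <= q)%N -> e q' < e p.
have next_ex q : exists q', (0 < q)%N ->
    better q q' /\ forall p, better q p -> (q' <= p)%N.
  have [->|q0] := posnP q; first by exists 0%N.
  have ex : exists q', `[< better q q' >].
    by have [q' [r [q'0 _ _ h]]] := st q q0; exists q'; apply/asboolP.
  exists (ex_minn ex) => _; case: ex_minnP => m /asboolP hm min; split => // p hp.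
  by apply: min; apply/asboolP.
have [next nextP] := choice next_ex.
pose qq n := iter n next 1%N.
have qq0 n : (0 < qq n)%N by elim: n => //= n /nextP [[]].
have qqS n : better (qq n) (qq n.+1) by case: (nextP _ (qq0 n)).
have qq_min n p : better (qq n) p -> (qq n.+1 <= p)%N by case: (nextP _ (qq0 n)) => _; apply.
have qq_lt n : (qq n < qq n.+1)%N.
  rewrite ltnNge; apply/negP => h; have [_ /(_ (qq n.+1))] := qqS n.
  by rewrite h qq0 ltxx => /(_ isT).
have qq_best n : best_approx alpha (qq n).
  case: n => [|n]; first by split => // p; rewrite -/(qq 0) /= => /andP[]; case: p.
  split; first exact: qq0.
  move=> p /andP[p0 pq]; have [_ h] := qqS n.
  have [pn|np] := leqP p (qq n); first by apply: h; rewrite p0.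
  rewrite ltNge; apply/negP => le; suff : better (qq n) p by move/qq_min; rewrite leqNgt pq.
  by split => // r hr; apply: le_lt_trans le _; exact: h.
have mono : {homo qq : m n / (m < n)%N}.
  by apply: homo_ltn => // a b c; exact: ltn_trans.
exists qq; split.
  split => //; apply/seteqP; split => [_ [n _ <-]|p [p1 hp]]; first exact: qq_best.
  have [n] : exists n, (p < qq n)%N.
    exists p.+1; elim: (p.+1) => // n IHn.
    exact: leq_trans (qq_lt n).
  elim: n => [|n IHn]; first by rewrite /= ltnS leqNgt p1.
  move=> pn; have [/IHn //|np] := ltnP p (qq n).
  exists n => //; apply/eqP; rewrite eqn_leq np /= leqNgt; apply/negP => lt.
  suff : better (qq n) p by move/qq_min; rewrite leqNgt pn.
  split=> // r /andP[r0 rn]; apply: hp; rewrite r0 /=.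
  exact: leq_ltn_trans rn lt.
have pos n : 0 < e (qq n).
  have [_ h] := qqS n; apply: le_lt_trans (h _ _); first exact: approx_err_ge0.
  by rewrite qq0 leqnn.
apply: (@lt_le_trans _ _ (64^-1)); first by rewrite invr_gt0.
apply: lb_le_inf; first by exists (e (qq 1) / e (qq 0)); exists 0%N.
move=> _ [n _ <-]; rewrite ler_pdivlMr; last exact: pos.
have [q' [r [q'0 /andP[r0 rq] h1 h2]]] := st _ (qq0 n).
have le : (qq n.+1 <= q')%N by apply: qq_min; split.
have := h1 (qq n.+1); rewrite qq0 le => /(_ isT).
have : e (qq n) <= e r.
  move: rq; rewrite leq_eqVlt => /orP[/eqP -> //|lt].
  by apply: ltW; case: (qq_best n) => _; apply; rewrite r0.
rewrite -/e; lra.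
Qed.

(** Integer points X_0, X_1, ... replace the best approximations: they need
    not be best, nor have monotone denominators.  If m is the least error up to q,
    the first X_(i+1) with error below m yields q', and no denominator up to
    that of X_(i+1) has an error much below that of X_i, which is at least m. *)
Lemma steady_chain (R : realType) (alpha : R * R) (X : nat -> vec) :
  (forall i, 0 < den (X i)) ->
  (forall n : nat, exists i, n%:Z <= den (X i)) ->
  (forall eta, 0 < eta -> exists i, res alpha (X i) < eta) ->
  (forall i x, 0 < den x <= den (X i.+1) -> res alpha (X i) < 64 * res alpha x) ->
  forall q : nat, den (X 0%N) <= q -> steady alpha q.
Proof.
move=> X0 Xd Xs Xg q hq.
have q0 : (0 < q)%N by have := X0 0%N; lia.
have err_X i : approx_err alpha `|den (X i)|%N <= res alpha (X i).
  by apply: approx_err_le_res; have := X0 i; lia.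
have gap i p : (0 < p <= `|den (X i.+1)|)%N -> res alpha (X i) < 64 * approx_err alpha p.
  move=> hp; have [x xp ->] := approx_err_attained alpha p.
  by apply: Xg; rewrite xp; have := X0 i.+1; lia.
have [r hr rmin] : exists2 r, (0 < r <= q)%N &
    forall p, (0 < p <= q)%N -> approx_err alpha r <= approx_err alpha p.
  move: {hq} q0; elim: q => // -[_ _|q IHq _].
    by exists 1%N => // -[|[]].
  have [r hr rm] := IHq isT.
  have [le|lt] := leP (approx_err alpha r) (approx_err alpha q.+2).
    exists r; first by lia.
    move=> p hp; have [->//|ne] := eqVneq p q.+2.
    by apply: rm; lia.
  exists q.+2; first by lia.
  move=> p hp; have [->//|ne] := eqVneq p q.+2.
  by apply: le_trans (ltW lt) _; apply: rm; lia.
have r_gt0 : 0 < approx_err alpha r.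
  have [i hi] : exists i, (r <= `|den (X i.+1)|)%N.
    have [[|i] hi] := Xd r.+1; last by exists i; lia.
    by have [j] := Xd (r + `|den (X 0%N)|)%N; case: j => [|j] hj; [lia | exists j; lia].
  have := gap i r; have := res_ge0 alpha (X i).
  by rewrite hi; move=> h /(_ ltac:(lia)); lra.
have [i hi] := Xs _ r_gt0.
have {i hi}[i [hi lo]] : exists i, res alpha (X i.+1) < approx_err alpha r /\
    approx_err alpha r <= res alpha (X i).
  elim: i hi => [|i IHi] hi.
    have := rmin `|den (X 0%N)|%N; have := X0 0%N.
    move=> ? /(_ ltac:(lia)); have := err_X 0%N; lra.
  have [/IHi //|] := ltP (res alpha (X i)) (approx_err alpha r).
  by move=> h; exists i.
exists `|den (X i.+1)|%N, r; split => //.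
- by have := X0 i.+1; lia.
- by move=> p /gap; apply: le_lt_trans.
- by move=> p /rmin; apply: lt_le_trans; apply: le_lt_trans (err_X _) hi.
Qed.

(** * Golden points on rational lines *)

(** (1, alpha) is proportional to v0 + phi v1 exactly when the error vectors
    satisfy e(v0) + phi e(v1) = 0; this form involves no division.  The vector u
    completes v0, v1 to a basis of Z^3. *)
Record gold (R : realType) (alpha : R * R) (u v0 v1 : vec) : Prop := Gold {
  gold_den0 : 0 < den v0;
  gold_den1 : den v0 <= den v1;
  gold_det : `|det3 u v0 v1| = 1;
  gold_err1 : err1 alpha v0 = - phi R * err1 alpha v1;
  gold_err2 : err2 alpha v0 = - phi R * err2 alpha v1 }.

(** The largest of the last two entries, in absolute value, of the cross product
    of v0 and v1: the covolume of the lattice they span, as far as distances to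
    the line through alpha are concerned. *)
Definition height (R : realType) (alpha : R * R) (v0 v1 : vec) : R :=
  ((den v0)%:~R + phi R * (den v1)%:~R) * res alpha v1.

Lemma gold_res (R : realType) (alpha : R * R) (u v0 v1 : vec) :
  gold alpha u v0 v1 -> res alpha v0 = phi R * res alpha v1.
Proof.
move=> G; rewrite (res_scale (gold_err1 G) (gold_err2 G)) normrN gtr0_norm //.
exact: phi_gt0.
Qed.

(** One Fibonacci step keeps the direction, because
    v1 + phi (v0 + v1) = phi (v0 + phi v1). *)
Lemma gold_shift (R : realType) (alpha : R * R) (u v0 v1 : vec) :
  gold alpha u v0 v1 -> gold alpha u v1 (v0 + v1).
Proof.
move=> [d0 d1 D l1 l2]; have hp := phi_sqr R.
split.
- exact: lt_le_trans d1.
- by rewrite [den (v0 + v1)](_ : _ = den v0 + den v1) // lerDr ltW.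
- by rewrite -D -normrN; congr `|_|; rewrite /det3 /=; ring.
- rewrite err1D l1; move: hp; set a := err1 _ _; set f := phi R => hp.
  by rewrite mulrDr mulrA mulNr mulrN hp; ring.
- rewrite err2D l2; move: hp; set a := err2 _ _; set f := phi R => hp.
  by rewrite mulrDr mulrA mulNr mulrN hp; ring.
Qed.

Lemma height_shift (R : realType) (alpha : R * R) (u v0 v1 : vec) :
  gold alpha u v0 v1 -> height alpha v1 (v0 + v1) = height alpha v0 v1.
Proof.
move=> G; rewrite /height (gold_res (gold_shift G)).
rewrite [den (v0 + v1)](_ : _ = den v0 + den v1) // intrD.
have hp := phi_sqr R; move: hp.
set a := _%:~R; set b := _%:~R; set r := res _ _; set f := phi R => hp.
have -> : (b + f * a) * (f * r) = (f * b + (f * f) * a) * r by ring.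
by rewrite hp; ring.
Qed.

(** The column operations p_i - q alpha_i have determinant one. *)
Lemma det3_err (R : realType) (alpha : R * R) (x y z : vec) :
  (det3 x y z)%:~R =
    (den x)%:~R * (err1 alpha y * err2 alpha z - err2 alpha y * err1 alpha z)
    - err1 alpha x * ((den y)%:~R * err2 alpha z - err2 alpha y * (den z)%:~R)
    + err2 alpha x * ((den y)%:~R * err1 alpha z - err1 alpha y * (den z)%:~R).
Proof. by rewrite /err1 /err2 /det3 /den !(intrD, intrM, mulrNz); ring. Qed.

Lemma det3_gold (R : realType) (alpha : R * R) (u v0 v1 x : vec) :
  gold alpha u v0 v1 ->
  (det3 x v0 v1)%:~R = ((den v0)%:~R + phi R * (den v1)%:~R) *
    (err2 alpha x * err1 alpha v1 - err1 alpha x * err2 alpha v1).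
Proof.
by move=> G; rewrite (det3_err alpha) (gold_err1 G) (gold_err2 G); ring.
Qed.

Lemma gold_weight_gt0 (R : realType) (alpha : R * R) (u v0 v1 : vec) :
  gold alpha u v0 v1 -> 0 < (den v0)%:~R + phi R * (den v1)%:~R.
Proof.
move=> G; apply: addr_gt0; first by rewrite ltr0z; exact: gold_den0 G.
apply: mulr_gt0; first exact: phi_gt0.
by rewrite ltr0z; exact: lt_le_trans (gold_den0 G) (gold_den1 G).
Qed.

(** Off the plane the determinant is a nonzero integer, and [det3_gold] bounds it
    by the error. *)
Lemma gold_off (R : realType) (alpha : R * R) (u v0 v1 x : vec) :
  gold alpha u v0 v1 -> det3 x v0 v1 != 0 ->
  1 <= 2 * height alpha v0 v1 * res alpha x.
Proof.
move=> G ne; have w0 := gold_weight_gt0 G.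
have : (1 : R) <= `|(det3 x v0 v1)%:~R|.
  by rewrite -intr_norm ler1z -gtz0_ge1 normr_gt0.
rewrite (det3_gold x G) normrM (gtr0_norm w0) /height.
set w := _ + _ in w0 *.
have a1 := err1_le_res alpha x; have a2 := err2_le_res alpha x.
have b1 := err1_le_res alpha v1; have b2 := err2_le_res alpha v1.
move=> h; apply: le_trans h _.
rewrite [leRHS](_ : _ = w * (res alpha x * res alpha v1 + res alpha x * res alpha v1));
  last by ring.
rewrite ler_pM2l //; apply: le_trans (ler_normB _ _) _.
by rewrite !normrM; apply: lerD; apply: ler_pM.
Qed.

Lemma gold_height_gt0 (R : realType) (alpha : R * R) (u v0 v1 : vec) :
  gold alpha u v0 v1 -> 0 < height alpha v0 v1 /\ 0 < res alpha u.
Proof.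
move=> G.
have ne : det3 u v0 v1 != 0 by rewrite -normr_gt0 (gold_det G).
have := gold_off G ne; have := res_ge0 alpha u.
have : 0 <= height alpha v0 v1.
  by apply: mulr_ge0; [exact: ltW (gold_weight_gt0 G) | exact: res_ge0].
by move=> h0 r0 h; split; rewrite lt_neqAle ?h0 ?r0 andbT;
  apply/negP => /eqP e; move: h; rewrite -e; lra.
Qed.

Lemma gold_res_gt0 (R : realType) (alpha : R * R) (u v0 v1 : vec) :
  gold alpha u v0 v1 -> 0 < res alpha v1.
Proof.
move=> G; have [+ _] := gold_height_gt0 G.
by rewrite /height pmulr_rgt0 //; exact: gold_weight_gt0 G.
Qed.

(** q times the error stays bounded along the Fibonacci points, as the height is
    invariant under [gold_shift]. *)
Lemma gold_den_res (R : realType) (alpha : R * R) (u v0 v1 : vec) :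
  gold alpha u v0 v1 -> (den v0)%:~R * res alpha v0 <= height alpha v0 v1.
Proof.
move=> G.
have -> : height alpha v0 v1 = (den v0)%:~R * res alpha v1 + (den v1)%:~R * res alpha v0.
  by rewrite (gold_res G) /height; ring.
have : (den v0)%:~R * res alpha v0 <= (den v1)%:~R * res alpha v0.
  by rewrite ler_wpM2r ?res_ge0 // ler_int; exact: gold_den1 G.
have q0 : 0 <= (den v0)%:~R :> R by rewrite ler0z ltW //; exact: gold_den0 G.
by move=> h; apply: le_trans h _; rewrite lerDr mulr_ge0 ?res_ge0.
Qed.

Lemma cramer (u v0 v1 x : vec) :
  zscale (det3 u v0 v1) x = zscale (det3 x v0 v1) u + zscale (det3 u x v1) v0
    + zscale (det3 u v0 x) v1.
Proof. by congr (_, _, _); rewrite /det3 /=; ring. Qed.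

Lemma unimodular_plane (u v0 v1 x : vec) :
  `|det3 u v0 v1| = 1 -> det3 x v0 v1 = 0 ->
  exists b c : int, x = zscale b v0 + zscale c v1.
Proof.
move=> D x0; have := cramer u v0 v1 x; rewrite x0.
set d := det3 _ _ _ in D *; set b := det3 _ _ _; set c := det3 _ _ _ => h.
exists (d * b), (d * c).
have dd : d * d = 1 by nia.
have -> : x = zscale d (zscale d x).
  by case: x {x0 b c h} => [[a b] c]; congr (_, _, _) => /=; rewrite mulrA dd mul1r.
by rewrite h; congr (_, _, _) => /=; ring.
Qed.

(** Write x = b v0 + c v1, whose error is |c - b phi| times that of v1.  The bounds
    on the denominator keep b and c from having the same sign, so nothing cancels. *)
Lemma gold_on (R : realType) (alpha : R * R) (u v0 v1 x : vec) :
  gold alpha u v0 v1 -> det3 x v0 v1 = 0 -> 0 < den x <= den v1 ->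
  res alpha v1 <= res alpha x.
Proof.
move=> G x0 hx; have [f1 f2] := phi_bounds R.
have [b [c xE]] := unimodular_plane (gold_det G) x0.
have hd : den x = b * den v0 + c * den v1 by rewrite xE.
have e : res alpha x = `|c%:~R - b%:~R * phi R| * res alpha v1.
  rewrite xE; apply: res_scale.
    by rewrite err1D !err1Z (gold_err1 G); ring.
  by rewrite err2D !err2Z (gold_err2 G); ring.
rewrite e ler_peMl ?res_ge0 //.
have q0 : 0 < den v0 := gold_den0 G; have q1 : den v0 <= den v1 := gold_den1 G.
rewrite {}hd in hx.
have [bn|bp|b0] := ltgtP b 0.
- have c1 : 1 <= c by nia.
  apply: le_trans (ler_norm _).
  have : (1 : R) <= c%:~R by rewrite ler1z.
  have : b%:~R < (0 : R) by rewrite ltrz0.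
  by nra.
- have c1 : c <= 0 by nia.
  rewrite -normrN; apply: le_trans (ler_norm _).
  have : c%:~R <= (0 : R) by rewrite lerz0.
  have : (1 : R) <= b%:~R by rewrite ler1z; lia.
  by nra.
- have c1 : 1 <= c by rewrite b0 in hx; nia.
  by rewrite b0 mul0r subr0; apply: le_trans (ler_norm _); rewrite ler1z.
Qed.

Lemma gold_near (R : realType) (alpha : R * R) (u v0 v1 x : vec) :
  gold alpha u v0 v1 -> 0 < den x <= den v1 ->
  res alpha v1 <= res alpha x \/ 1 <= 2 * height alpha v0 v1 * res alpha x.
Proof.
move=> G hx; have [x0|ne] := eqVneq (det3 x v0 v1) 0.
  by left; exact: gold_on G x0 hx.
by right; exact: gold_off G ne.
Qed.

Fixpoint fibv (v0 v1 : vec) (j : nat) : vec :=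
  if j is j'.+1 then fibv v1 (v0 + v1) j' else v0.

Lemma gold_fibv (R : realType) (alpha : R * R) (u v0 v1 : vec) (j : nat) :
  gold alpha u v0 v1 ->
  gold alpha u (fibv v0 v1 j) (fibv v0 v1 j.+1) /\
  height alpha (fibv v0 v1 j) (fibv v0 v1 j.+1) = height alpha v0 v1.
Proof.
elim: j v0 v1 => [|j IH] v0 v1 G; first by [].
have [G' e] := IH _ _ (gold_shift G); split; first exact: G'.
by rewrite -(height_shift G) -e.
Qed.

Lemma fibv_den_mono (R : realType) (alpha : R * R) (u v0 v1 : vec) (i j : nat) :
  gold alpha u v0 v1 -> (i <= j)%N -> den (fibv v0 v1 i) <= den (fibv v0 v1 j).
Proof.
move=> G; elim: j => [|j IH]; first by rewrite leqn0 => /eqP ->.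
rewrite leq_eqVlt => /orP[/eqP -> //|/IH le].
by apply: le_trans le _; have [/gold_den1] := gold_fibv j G.
Qed.

Lemma fibv_res_mono (R : realType) (alpha : R * R) (u v0 v1 : vec) (i j : nat) :
  gold alpha u v0 v1 -> (i <= j)%N -> res alpha (fibv v0 v1 j) <= res alpha (fibv v0 v1 i).
Proof.
move=> G; elim: j => [|j IH]; first by rewrite leqn0 => /eqP ->.
rewrite leq_eqVlt => /orP[/eqP -> //|/IH le].
apply: le_trans _ le; have [/gold_res -> _] := gold_fibv j G.
by rewrite ler_peMl ?res_ge0 //; have := phi_bounds R; lra.
Qed.

Lemma fibv_den_large (R : realType) (alpha : R * R) (u v0 v1 : vec) (n : nat) :
  gold alpha u v0 v1 -> exists j, n%:Z <= den (fibv v0 v1 j).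
Proof.
move=> G; exists n.
suff : n%:Z <= den (fibv v0 v1 n) /\ n.+1%:Z <= den (fibv v0 v1 n.+1) by case.
elim: n v0 v1 G => [|n IH] v0 v1 G.
  by have := gold_den0 G; have := gold_den1 G => /=; lia.
have [h1 h2] := IH _ _ G; split => //.
have [G' _] := gold_fibv n G.
have -> : fibv v0 v1 n.+2 = fibv v0 v1 n + fibv v0 v1 n.+1.
  by elim: (n) v0 v1 {IH G h1 h2 G'} => //= k IHk v0 v1; rewrite -IHk.
rewrite [den (_ + _)](_ : _ = den (fibv v0 v1 n) + den (fibv v0 v1 n.+1)) //.
by have := gold_den0 G'; lia.
Qed.

Lemma fibv_res_small (R : realType) (alpha : R * R) (u v0 v1 : vec) (eta : R) :
  gold alpha u v0 v1 -> 0 < eta -> exists j, res alpha (fibv v0 v1 j) < eta.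
Proof.
move=> G eta0; have [f1 f2] := phi_bounds R.
(* 1 + j / 2 is a linear minorant of phi ^ j. *)
have dec j : res alpha (fibv v0 v1 j) * (1 + j%:R / 2) <= res alpha v0.
  elim: j => [|j IH]; first by rewrite mul0r addr0 mulr1.
  apply: le_trans _ IH; have [/gold_res -> _] := gold_fibv j G.
  rewrite [phi R * _]mulrC -mulrA ler_wpM2l ?res_ge0 // -natr1.
  by have : 0 <= j%:R :> R by []; nra.
pose j := Num.bound (2 * res alpha v0 / eta); exists j.
have hj : 2 * res alpha v0 / eta < j%:R.
  by apply: archi_boundP; rewrite !mulr_ge0 ?res_ge0 ?invr_ge0 // ltW.
rewrite ltr_pdivrMr // in hj.
rewrite ltNge; apply/negP => le; have := dec j; have : 0 <= j%:R :> R by []; nra.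
Qed.

(** The hypothesis of [steady_chain] for the Fibonacci points.  The bound on the
    height makes the points off the plane harmless from v0 on. *)
Lemma gold_gap (R : realType) (alpha : R * R) (u v0 v1 : vec) (i : nat) (x : vec) :
  gold alpha u v0 v1 -> height alpha v0 v1 * res alpha v0 <= 1 ->
  0 < den x <= den (fibv v0 v1 i.+1) ->
  res alpha (fibv v0 v1 i) < 64 * res alpha x.
Proof.
move=> G small hx; have [f1 f2] := phi_bounds R.
have [G' hE] := gold_fibv i G.
have le := fibv_res_mono G (leq0n i); rewrite [fibv _ _ 0]/= in le.
have p1 := gold_res_gt0 G'.
have [H0 _] := gold_height_gt0 G.
have e := gold_res G'.
have [near|] := gold_near G' hx; first by nra.
rewrite hE => far; have h0 := res_ge0 alpha x.
have x0 : 0 < res alpha x.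
  by rewrite lt_neqAle h0 andbT; apply/negP => /eqP z; move: far; rewrite -z; lra.
rewrite ltNge; apply/negP => big.
have : res alpha x <= res alpha v0 / 64 by lra.
have : 0 <= res alpha v0 by exact: res_ge0.
by nra.
Qed.

Lemma gold_steady (R : realType) (alpha : R * R) (u v0 v1 : vec) :
  gold alpha u v0 v1 -> height alpha v0 v1 * res alpha v0 <= 1 ->
  forall q : nat, den v0 <= q -> steady alpha q.
Proof.
move=> G small; apply: (@steady_chain _ _ (fibv v0 v1)).
- by move=> i; have [/gold_den0] := gold_fibv i G.
- by move=> n; exact: (fibv_den_large n G).
- by move=> eta; exact: (fibv_res_small G).
- by move=> i x; exact: (gold_gap G small).
Qed.

(** * Turning to another rational line *)

(** The determinant y a - x b is fixed, so once x, the coordinate along the dominant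
    side of (a, b), is small, y is controlled as well. *)
Lemma reduce_bound (R : realType) (w a b x y f : R) : 0 < w ->
  `|b| <= `|a| -> `|x| <= f * `|a| -> w * `|a| * (f * `|a|) <= 1 ->
  w * `|y * a - x * b| = 1 ->
  w * `|a| * `|x| <= 2 /\ w * `|a| * `|y| <= 2.
Proof.
move=> w0 ba xa h e.
have wa : 0 <= w * `|a| by rewrite mulr_ge0 // ltW.
have h1 : w * `|a| * `|x| <= 1 by apply: le_trans h; rewrite ler_wpM2l.
split; first by lra.
have : `|y * a| <= `|y * a - x * b| + `|x * b|.
  by rewrite -[X in `|X| <= _](subrK (x * b)); exact: ler_normD.
rewrite !normrM -(ler_pM2l w0) mulrDr e => h2.
have : w * (`|x| * `|b|) <= w * `|a| * `|x|.
  by rewrite -mulrA ler_pM2l // mulrC ler_wpM2r.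
rewrite -mulrA [`|a| * _]mulrC; lra.
Qed.

Lemma floor_frac (R : realType) (x y : R) : y != 0 ->
  exists t : int, `|x - t%:~R * y| <= `|y|.
Proof.
move=> y0; exists (Num.floor (x / y)).
have h1 : (Num.floor (x / y))%:~R <= x / y by exact: floor_le.
have h2 : x / y < (Num.floor (x / y) + 1)%:~R by exact: floorD1_gt.
rewrite intrD in h2.
have -> : x - (Num.floor (x / y))%:~R * y = (x / y - (Num.floor (x / y))%:~R) * y.
  by rewrite mulrBl divfK.
rewrite normrM ler_piMl // ler_norml; apply/andP; split; lra.
Qed.

(** The component of e(u) across the line is fixed by the determinant, of order
    1 / height; its component along the line can be reduced modulo e(v0). *)
Lemma gold_reduce (R : realType) (alpha : R * R) (u v0 v1 : vec) :
  gold alpha u v0 v1 -> height alpha v0 v1 * res alpha v0 <= 1 ->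
  exists u', gold alpha u' v0 v1 /\ height alpha v0 v1 * res alpha u' <= 2.
Proof.
move=> G small; have f0 := phi_gt0 R.
have r0 := gold_res_gt0 G; have w0 := gold_weight_gt0 G.
have G' t : gold alpha (u + zscale (- t) v0) v0 v1.
  case: (G) => d0 d1 D l1 l2; split => //.
  by rewrite -D; congr `|_|; rewrite /det3 /=; ring.
have D t : ((den v0)%:~R + phi R * (den v1)%:~R) *
    `|err2 alpha (u + zscale (- t) v0) * err1 alpha v1 -
      err1 alpha (u + zscale (- t) v0) * err2 alpha v1| = 1 :> R.
  rewrite -[X in X * _](gtr0_norm w0) -normrM -(det3_gold _ G) -intr_norm.
  by rewrite (gold_det (G' t)).
rewrite (gold_res G) /height in small *.
set w := _ + _ in w0 D small *.
have [ba|ab] := leP `|err2 alpha v1| `|err1 alpha v1|.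
- have rE : res alpha v1 = `|err1 alpha v1| by rewrite /res; apply/max_idPl.
  rewrite rE in r0 small *.
  have ne : err1 alpha v0 != 0.
    by rewrite (gold_err1 G) mulf_eq0 oppr_eq0 (gt_eqF f0) /= -normr_gt0.
  have [t ht] := floor_frac (err1 alpha u) ne.
  exists (u + zscale (- t) v0); split => //.
  have hx : `|err1 alpha (u + zscale (- t) v0)| <= phi R * `|err1 alpha v1|.
    rewrite err1D err1Z mulrNz mulNr; apply: le_trans ht _.
    by rewrite (gold_err1 G) normrM normrN (gtr0_norm f0).
  have [h1 h2] := reduce_bound w0 ba hx small (D t).
  by rewrite /res maxr_pMr ?ge_max ?h1 ?h2 // mulr_ge0 // ltW.
- have rE : res alpha v1 = `|err2 alpha v1| by rewrite /res; apply/max_idPr; exact: ltW.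
  rewrite rE in r0 small *.
  have ne : err2 alpha v0 != 0.
    by rewrite (gold_err2 G) mulf_eq0 oppr_eq0 (gt_eqF f0) /= -normr_gt0.
  have [t ht] := floor_frac (err2 alpha u) ne.
  exists (u + zscale (- t) v0); split => //.
  have hx : `|err2 alpha (u + zscale (- t) v0)| <= phi R * `|err2 alpha v1|.
    rewrite err2D err2Z mulrNz mulNr; apply: le_trans ht _.
    by rewrite (gold_err2 G) normrM normrN (gtr0_norm f0).
  have D' := D t; rewrite -normrN opprB in D'.
  have [h1 h2] := reduce_bound w0 (ltW ab) hx small D'.
  by rewrite /res maxr_pMr ?ge_max ?h1 ?h2 // mulr_ge0 // ltW.
Qed.

(** The new direction is v + phi w with w = u + m v.  Seen from it, the error of v is
    phi M / qd, where M = |q_u e(v) - q_v e(u)| does not depend on m and qd is the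
    first coordinate of v + phi w.  So m only serves to put qd in the right range,
    and M turns out to be the new height. *)
Lemma gold_turn (R : realType) (alpha : R * R) (u v v' : vec) :
  gold alpha u v v' -> height alpha v v' * res alpha u <= 2 ->
  res alpha v <= res alpha u / 2 ->
  `|(den u)%:~R| * res alpha v <= res alpha u / 2 ->
  exists alpha' w m, [/\ w = u + zscale m v, gold alpha' v' v w,
    res alpha v / 8 <= res alpha' v <= res alpha v / 4,
    height alpha' v w * res alpha v <= 4 &
    (den v)%:~R * dist alpha alpha' <= 5 / 4 * res alpha v].
Proof.
move=> G HE small1 small2.
have [f1 f2] := phi_bounds R; have f0 := phi_gt0 R.
have eps0 : 0 < res alpha v by rewrite (gold_res G) mulr_gt0 //; exact: gold_res_gt0 G.
have [H0 E0] := gold_height_gt0 G.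
have qv1 : 1 <= (den v)%:~R :> R by rewrite ler1z -gtz0_ge1; exact: gold_den0 G.
have qv0 : 0 < (den v)%:~R :> R by lra.
have Heps := gold_den_res G.
pose y1 := (den u)%:~R * err1 alpha v - (den v)%:~R * err1 alpha u.
pose y2 := (den u)%:~R * err2 alpha v - (den v)%:~R * err2 alpha u.
pose M := Num.max `|y1| `|y2|.
have side (a b : R) : `|a| <= res alpha v ->
   `|(den u)%:~R * a - (den v)%:~R * b| <= (den v)%:~R * `|b| + res alpha u / 2 /\
   (den v)%:~R * `|b| - res alpha u / 2 <= `|(den u)%:~R * a - (den v)%:~R * b|.
  move=> ha.
  have hq : `|(den u)%:~R * a| <= res alpha u / 2.
    by apply: le_trans small2; rewrite normrM ler_wpM2l.
  have hb : `|(den v)%:~R * b| = (den v)%:~R * `|b| by rewrite normrM gtr0_norm.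
  split.
    by apply: le_trans (ler_normB _ _) _; rewrite hb; lra.
  have := ler_normB ((den u)%:~R * a) ((den u)%:~R * a - (den v)%:~R * b).
  by rewrite subKr hb; lra.
have [s1 s1'] := side _ (err1 alpha u) (err1_le_res alpha v).
have [s2 s2'] := side _ (err2 alpha u) (err2_le_res alpha v).
have Mup : M <= 2 * ((den v)%:~R * res alpha u).
  have a1 := err1_le_res alpha u; have a2 := err2_le_res alpha u.
  have t : res alpha u / 2 <= (den v)%:~R * res alpha u by nra.
  rewrite /M ge_max -/y1 -/y2 in s1 s2 *; apply/andP; split.
    by apply: le_trans s1 _; nra.
  by apply: le_trans s2 _; nra.
have Mlo : (den v)%:~R * res alpha u / 2 <= M.
  have : `|y1| <= M /\ `|y2| <= M by rewrite /M !le_max !lexx orbT.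
  move=> [m1 m2].
  have t : res alpha u / 2 <= (den v)%:~R * res alpha u / 2 by nra.
  have : res alpha u = `|err1 alpha u| \/ res alpha u = `|err2 alpha u|.
    by rewrite /res; case: leP; [right|left].
  by move=> [e|e]; rewrite e in t s1' s2' *; [apply: le_trans m1 | apply: le_trans m2];
   [apply: le_trans s1' | apply: le_trans s2']; lra.
have M0 : 0 < M by nra.
(* qd >= B makes the new error at most eps / 4; steps of size phi q_v in m let qd
   stay below 2 B, which makes it at least eps / 8. *)
pose B := 4 * phi R * M / res alpha v.
have BE : B * res alpha v = 4 * phi R * M by rewrite /B divfK // gt_eqF.
pose C := (B - (den v)%:~R - phi R * (den u)%:~R) / (phi R * (den v)%:~R).
have pq0 : 0 < phi R * (den v)%:~R by rewrite mulr_gt0.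
pose m := Num.floor C + 1.
pose w : vec := u + zscale m v.
pose qd : R := (den v)%:~R + phi R * (den w)%:~R.
have qwE : (den w)%:~R = (den u)%:~R + m%:~R * (den v)%:~R :> R.
  by rewrite /w /den /= intrD intrM.
have CE : C * (phi R * (den v)%:~R) = B - (den v)%:~R - phi R * (den u)%:~R.
  by rewrite /C divfK // gt_eqF.
have qd_lo : B <= qd.
  have : C < m%:~R by exact: floorD1_gt.
  rewrite -(ltr_pM2r pq0) CE /qd qwE; lra.
have qd_up : qd <= B + phi R * (den v)%:~R.
  have : (Num.floor C)%:~R <= C by exact: floor_le.
  rewrite -(ler_pM2r pq0) CE /qd qwE /m intrD; lra.
have B4 : 4 * (phi R * (den v)%:~R) <= B.
  rewrite -(ler_pM2r eps0) BE; nra.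
have qd0 : 0 < qd by lra.
have qw_ge : den v <= den w.
  rewrite -(ler_int R) -(ler_pM2l f0); rewrite /qd in qd_lo; nra.
pose alpha' : R * R :=
  ((v.1.2%:~R + phi R * w.1.2%:~R) / qd, (v.2%:~R + phi R * w.2%:~R) / qd).
have qdn : qd != 0 by rewrite gt_eqF.
have l1v : err1 alpha' v = phi R / qd * y1.
  have pw : w.1.2%:~R = u.1.2%:~R + m%:~R * v.1.2%:~R :> R by rewrite /= intrD intrM.
  rewrite /err1 /= /y1 /err1 pw; move: qdn; rewrite /qd qwE => qdn; field.
  exact: qdn.
have l2v : err2 alpha' v = phi R / qd * y2.
  have pw : w.2%:~R = u.2%:~R + m%:~R * v.2%:~R :> R by rewrite /= intrD intrM.
  rewrite /err2 /= /y2 /err2 pw; move: qdn; rewrite /qd qwE => qdn; field.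
  exact: qdn.
have l1w : err1 alpha' v = - phi R * err1 alpha' w.
  rewrite /err1 /=; move: qdn; rewrite /qd => qdn; field.
  exact: qdn.
have l2w : err2 alpha' v = - phi R * err2 alpha' w.
  rewrite /err2 /=; move: qdn; rewrite /qd => qdn; field.
  exact: qdn.
have G' : gold alpha' v' v w.
  split => //; first exact: gold_den0 G.
  by rewrite -(gold_det G) -normrN; congr `|_|; rewrite /det3 /w /=; ring.
have rv : qd * res alpha' v = phi R * M.
  have c0 := divr_gt0 f0 qd0.
  rewrite {1}/res l1v l2v !(normrM (phi R / qd)) (gtr0_norm c0).
  rewrite -maxr_pMr -/M; last exact: ltW.
  by rewrite mulrA mulrCA divff // mulr1.
have rlo : res alpha v / 8 <= res alpha' v.
  rewrite -(ler_pM2l qd0) rv; nra.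
have rup : res alpha' v <= res alpha v / 4.
  rewrite -(ler_pM2l qd0) rv; nra.
exists alpha', w, m; split => //; first by rewrite rlo rup.
- have -> : height alpha' v w = M.
    apply: (mulfI (lt0r_neq0 f0)); rewrite -rv (gold_res G') /height -/qd; ring.
  have : M * res alpha v <= 2 * ((den v)%:~R * res alpha u) * res alpha v by rewrite ler_pM2r.
  have : (den v)%:~R * res alpha v * res alpha u <= height alpha v v' * res alpha u.
    by rewrite ler_pM2r.
  lra.
- apply: le_trans (dist_le_res alpha alpha' (ltW (gold_den0 G))) _.
  by rewrite -lerBrDr; apply: le_trans rup _; clear -eps0; lra.
Qed.

(** * Open conditions *)

Definition nearby (R : realType) (alpha : R * R) (P : R * R -> Prop) : Prop :=
  exists2 d : R, 0 < d & forall beta, dist alpha beta <= d -> P beta.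

Lemma nearby_and (R : realType) (alpha : R * R) (P Q : R * R -> Prop) :
  nearby alpha P -> nearby alpha Q -> nearby alpha (fun beta => P beta /\ Q beta).
Proof.
move=> [d d0 hP] [d' d'0 hQ]; exists (Num.min d d'); first by rewrite lt_min d0.
by move=> beta; rewrite le_min => /andP[/hP ? /hQ].
Qed.

Lemma nearby_forall (R : realType) (alpha : R * R) (n : nat) (P : nat -> R * R -> Prop) :
  (forall p, (p < n)%N -> nearby alpha (P p)) ->
  nearby alpha (fun beta => forall p, (p < n)%N -> P p beta).
Proof.
elim: n => [|n IH] h; first by exists 1.
have hn : nearby alpha (P n) by apply: h.
have hlt : nearby alpha (fun beta => forall p, (p < n)%N -> P p beta).
  by apply: IH => p pn; apply: h; exact: ltnW.
have [d d0 hd] := nearby_and hn hlt.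
exists d => // beta /hd[h1 h2] p; rewrite ltnS leq_eqVlt => /orP[/eqP -> //|].
exact: h2.
Qed.

(** One form that covers the inequalities between two errors (t = 0) and those
    between an error and a constant (b = 0). *)
Lemma nearby_err_lt (R : realType) (alpha : R * R) (p r : nat) (a b t : R) :
  0 <= a -> 0 <= b -> a * approx_err alpha r < b * approx_err alpha p + t ->
  nearby alpha (fun beta => a * approx_err beta r < b * approx_err beta p + t).
Proof.
move=> a0 b0 lt; pose gap := b * approx_err alpha p + t - a * approx_err alpha r.
have s0 : 0 <= a * r%:R + b * p%:R by rewrite addr_ge0 // mulr_ge0.
have g0 : 0 < gap by rewrite subr_gt0.
have s1 : 0 < a * r%:R + b * p%:R + 1 by apply: ltr_wpDl.
exists (gap / (a * r%:R + b * p%:R + 1)); first by rewrite divr_gt0.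
move=> beta; rewrite ler_pdivlMr // => hd.
have h1 := approx_err_perturb alpha beta r.
have := approx_err_perturb beta alpha p; rewrite dist_sym => h2.
have e1 : a * approx_err beta r <= a * (approx_err alpha r + r%:R * dist alpha beta).
  by rewrite ler_wpM2l.
have e2 : b * approx_err alpha p <= b * (approx_err beta p + p%:R * dist alpha beta).
  by rewrite ler_wpM2l.
have [d0|] := ltP 0 (dist alpha beta).
  by move: hd; rewrite /gap => hd; clear -hd d0 e1 e2; lra.
rewrite le_eqVlt => /orP[/eqP d0|]; last first.
  by rewrite ltNge dist_ge0.
by move: e1 e2; rewrite d0 !mulr0 !addr0; lra.
Qed.

Lemma nearby_steady (R : realType) (alpha : R * R) (q : nat) :
  steady alpha q -> nearby alpha (fun beta => steady beta q).
Proof.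
move=> [q' [r [q'0 hr h1 h2]]].
have n1 : nearby alpha (fun beta => forall p, (p < q'.+1)%N -> (0 < p)%N ->
    1 * approx_err beta r < 64 * approx_err beta p + 0).
  apply: nearby_forall => p pq; have [->|p0] := posnP p; first by exists 1.
  have lt : 1 * approx_err alpha r < 64 * approx_err alpha p + 0.
    by rewrite mul1r addr0; apply: h1; rewrite p0.
  have [d d0 hd] := nearby_err_lt ler01 (ler0n R 64) lt.
  by exists d => // beta /hd.
have n2 : nearby alpha (fun beta => forall p, (p < q.+1)%N -> (0 < p)%N ->
    1 * approx_err beta q' < 1 * approx_err beta p + 0).
  apply: nearby_forall => p pq; have [->|p0] := posnP p; first by exists 1.
  have lt : 1 * approx_err alpha q' < 1 * approx_err alpha p + 0.
    by rewrite !mul1r addr0; apply: h2; rewrite p0.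
  have [d d0 hd] := nearby_err_lt ler01 ler01 lt.
  by exists d => // beta /hd.
have [d d0 hd] := nearby_and n1 n2; exists d => // beta /hd[g1 g2].
exists q', r; split => // p /andP[p0 ple].
  by have := g1 p ple p0; rewrite mul1r addr0.
by have := g2 p ple p0; rewrite !mul1r addr0.
Qed.

(** * Rational lines through a golden point *)

(** The rational line with coefficients l, which is no condition when l = 0. *)
Definition on_line (R : realType) (alpha : R * R) (l : vec) : Prop :=
  l.1.1%:~R + l.1.2%:~R * alpha.1 + l.2%:~R * alpha.2 = 0.

Definition dot (l x : vec) : int := l.1.1 * x.1.1 + l.1.2 * x.1.2 + l.2 * x.2.

Lemma dot_on_line (R : realType) (alpha : R * R) (l x : vec) : on_line alpha l ->
  (dot l x)%:~R = - (l.1.2%:~R * err1 alpha x + l.2%:~R * err2 alpha x).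
Proof.
rewrite /on_line /dot /err1 /err2 /den !(intrD, intrM) => h.
rewrite -[LHS]subr0 -[X in _ - X](mulr0 (x.1.1%:~R)) -h; ring.
Qed.

(** Along the Fibonacci points the integers l . v_j are combinations of the errors, so they
    tend to 0 and vanish from some j on; the recurrence carries this back to v0. *)
Lemma gold_on_line (R : realType) (alpha : R * R) (u v0 v1 l : vec) :
  gold alpha u v0 v1 -> on_line alpha l -> dot l v0 = 0 /\ dot l v1 = 0.
Proof.
move=> G hl.
have back v v' : gold alpha u v v' -> (dot l v)%:~R = - phi R * (dot l v')%:~R.
  by move=> G'; rewrite !(dot_on_line _ hl) (gold_err1 G') (gold_err2 G'); ring.
pose s : R := `|l.1.2%:~R| + `|l.2%:~R|.
have s0 : 0 <= s by rewrite addr_ge0.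
have s1 : 0 < (s + 1)^-1 by rewrite invr_gt0 ltr_wpDl.
have [j hj] := fibv_res_small G s1.
have : dot l (fibv v0 v1 j) = 0.
  apply/eqP; rewrite -normr_le0 -ltzD1 add0r -(ltr_int R) intr_norm (dot_on_line _ hl) normrN.
  apply: le_lt_trans (ler_normD _ _) _; rewrite !normrM.
  apply: (@le_lt_trans _ _ (s * res alpha (fibv v0 v1 j))).
    by rewrite /s mulrDl lerD // ler_wpM2l // ?err1_le_res ?err2_le_res.
  have r0 := res_ge0 alpha (fibv v0 v1 j).
  move: hj; rewrite -[_^-1]mul1r ltr_pdivlMr ?ltr_wpDl // => hj.
  by clear -hj r0; lra.
have d0 : dot l (fibv v0 v1 j) = 0 -> dot l v0 = 0.
  elim: j {hj} => // j IH h; apply: IH; have [G' _] := gold_fibv j G.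
  by apply/eqP; rewrite -(intr_eq0 R) (back _ _ G') h mulr0.
move=> /d0 h; split => //; apply/eqP; rewrite -(intr_eq0 R).
have := back _ _ G; rewrite h => /esym/eqP.
by rewrite mulf_eq0 oppr_eq0 (gt_eqF (phi_gt0 R)).
Qed.

Lemma eq0_of_dot0 (R : realType) (alpha : R * R) (u v v' l : vec) :
  gold alpha u v v' -> dot l u = 0 -> dot l v = 0 -> dot l v' = 0 -> l = (0, 0, 0).
Proof.
move=> G h1 h2 h3; have D := gold_det G.
have dotD x y : dot l (x + y) = dot l x + dot l y by rewrite /dot /=; ring.
have dotZ m x : dot l (zscale m x) = m * dot l x by rewrite /dot /=; ring.
have z x : dot l x = 0.
  have := congr1 (dot l) (cramer u v v' x).
  rewrite !dotD !dotZ h1 h2 h3 !mulr0 !addr0 => /eqP; rewrite mulf_eq0 => /orP[/eqP e|/eqP //].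
  by rewrite e in D.
have := z (1, 0, 0); have := z (0, 1, 0); have := z (0, 0, 1).
rewrite /dot; case: l {h1 h2 h3 dotD dotZ z} => [[a b] c] /=.
by rewrite !mulr0 !mulr1 !addr0 !add0r => -> -> ->.
Qed.

(** * Tame points *)

(** Before the turn: a move of alpha that changes the errors by at most 5/4 eps is
    harmless while the errors are at least phi eps, because 5/4 < phi. *)
Lemma turn_gap (R : realType) (alpha beta : R * R) (u v0 v1 x : vec) (eps : R) :
  gold alpha u v0 v1 -> 2 * height alpha v0 v1 * res alpha v1 <= 1 ->
  0 < eps -> phi R * eps <= res alpha v1 ->
  (den v1)%:~R * dist alpha beta <= 5 / 4 * eps ->
  0 < den x <= den v1 -> res beta v0 < 64 * res beta x.
Proof.
move=> G small eps0 he hd hx; have [f1 f2] := phi_bounds R.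
have d0 := dist_ge0 alpha beta.
have x0 : 0 < den x by case/andP: hx.
have near : res alpha v1 <= res alpha x.
  have [//|far] := gold_near G hx.
  have [H0 _] := gold_height_gt0 G.
  rewrite -(ler_pM2l (_ : 0 < 2 * height alpha v0 v1)); last by rewrite mulr_gt0.
  exact: le_trans small far.
have px : res alpha x <= res beta x + (den x)%:~R * dist alpha beta.
  by rewrite dist_sym; apply: res_perturb; exact: ltW.
have pv : res beta v0 <= res alpha v0 + (den v0)%:~R * dist alpha beta.
  by apply: res_perturb; exact: ltW (gold_den0 G).
have dx : (den x)%:~R * dist alpha beta <= 5 / 4 * eps.
  by apply: le_trans hd; rewrite ler_wpM2r // ler_int; case/andP: hx.
have dv : (den v0)%:~R * dist alpha beta <= 5 / 4 * eps.
  by apply: le_trans hd; rewrite ler_wpM2r // ler_int; exact: gold_den1 G.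
rewrite (gold_res G) in pv; have r0 := res_ge0 alpha v1.
have t1 : 8 / 5 * eps <= res alpha v1 by apply: le_trans he; rewrite ler_wpM2r // ltW.
have t2 : phi R * res alpha v1 <= 17 / 10 * res alpha v1 by rewrite ler_wpM2r // ltW.
clear -t1 t2 pv dv dx px near r0 eps0; lra.
Qed.

Definition tame (R : realType) (alpha : R * R) : Prop :=
  (exists u v0 v1, gold alpha u v0 v1) /\ (forall q, (0 < q)%N -> steady alpha q).

(** The chain of the new point follows the old Fibonacci points up to v and then
    those generated by v and w.  Small q, below the start of the chain, are covered
    by openness, the turn being taken far enough out. *)
Lemma tame_step (R : realType) (alpha : R * R) (d : R) : tame alpha -> 0 < d ->
  exists beta, [/\ tame beta, dist alpha beta <= d, beta <> alpha &
    forall l, on_line alpha l -> on_line beta l -> l = (0, 0, 0)].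
Proof.
move=> [[u [v0 [v1 G]]] st] d0; have [f1 f2] := phi_bounds R.
have {u v0 v1 G} [u [v0 [v1 [G small HE]]]] : exists u v0 v1,
    [/\ gold alpha u v0 v1, 2 * height alpha v0 v1 * res alpha v0 <= 1 &
        height alpha v0 v1 * res alpha u <= 2].
  have [H0 _] := gold_height_gt0 G.
  have e0 : 0 < (2 * height alpha v0 v1)^-1 by rewrite invr_gt0 mulr_gt0.
  have [j hj] := fibv_res_small G e0; have [G' hE] := gold_fibv j G.
  have small : 2 * height alpha v0 v1 * res alpha (fibv v0 v1 j) <= 1.
    by rewrite -ler_pdivlMl ?mulr1; [exact: ltW | exact: mulr_gt0].
  have small' : height alpha v0 v1 * res alpha (fibv v0 v1 j) <= 1.
    have : 0 <= height alpha v0 v1 * res alpha (fibv v0 v1 j).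
      by rewrite mulr_ge0 ?res_ge0 // ltW.
    by clear -small; lra.
  rewrite -hE in small small' *.
  have [u' [Gu hu]] := gold_reduce G' small'.
  by exists u', (fibv v0 v1 j), (fibv v0 v1 j.+1).
have [d1 d10 hd1] : nearby alpha (fun beta => forall q, (q < `|den v0|)%N ->
    (0 < q)%N -> steady beta q).
  apply: nearby_forall => q _; have [->|q0] := posnP q; first by exists 1.
  by have [e e0 he] := nearby_steady (st q q0); exists e => // beta /he.
have [H0 E0] := gold_height_gt0 G.
(* The last two bounds are what the turn asks for, the first two keep the new
   point within d and d1. *)
pose tau := Num.min (Num.min (d / 2) (d1 / 2))
  (Num.min (res alpha u / 2) (res alpha u / 2 / (`|(den u)%:~R| + 1))).
have n1 : 0 < `|(den u)%:~R| + 1 :> R by rewrite ltr_wpDl.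
have tau0 : 0 < tau by rewrite !lt_min !divr_gt0.
have [k hk] := fibv_res_small G tau0.
have [Gk hE] := gold_fibv k G.
have dk0 := gold_den0 Gk.
have : height alpha (fibv v0 v1 k) (fibv v0 v1 k.+1) * res alpha u <= 2 by rewrite hE.
set v := fibv v0 v1 k in Gk hk dk0 *; set v' := fibv v0 v1 k.+1 in Gk *.
move: hk; rewrite !lt_min => /andP[/andP[e1 e2] /andP[e3 e4]] HE'.
have e4' : `|(den u)%:~R| * res alpha v <= res alpha u / 2.
  rewrite ltr_pdivlMr // in e4; have := res_ge0 alpha v.
  by clear -e4; lra.
have [beta [w [m [wE Gb /andP[b1 b2] hb hd]]]] := gold_turn Gk HE' (ltW e3) e4'.
have eps0 : 0 < res alpha v.
  by rewrite (gold_res Gk) mulr_gt0 ?phi_gt0 //; exact: gold_res_gt0 Gk.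
have hdist : dist alpha beta <= 5 / 4 * res alpha v.
  apply: le_trans hd; rewrite ler_peMl //; first exact: dist_ge0.
  by rewrite ler1z -gtz0_ge1.
have smallb : height beta v w * res beta v <= 1.
  have [Hb _] := gold_height_gt0 Gb.
  have : height beta v w * res beta v <= height beta v w * (res alpha v / 4).
    by rewrite ler_wpM2l // ltW.
  by clear -hb; lra.
exists beta; split.
- split; first by exists v', v, w.
  move=> q q0; have [lt|ge] := ltnP q `|den v0|.
    by apply: hd1 lt q0; clear -hdist e2 eps0; lra.
  (* The junction is consistent, since fibv v w 0 = v = fibv v0 v1 k. *)
  pose X i := if (i < k)%N then fibv v0 v1 i else fibv v w (i - k).
  have X0 : X 0%N = v0 by rewrite /X /v; case: (k).
  have XS i : (i < k)%N -> X i.+1 = fibv v0 v1 i.+1.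
    rewrite /X leq_eqVlt => /orP[/eqP e|->//].
    by rewrite -e ltnn subnn /= /v -e.
  have XG i : (k <= i)%N -> X i = fibv v w (i - k) by rewrite /X ltnNge => ->.
  have q0' : den (X 0%N) <= q by rewrite X0 -lez_nat (gtz0_abs (gold_den0 G)) in ge *.
  apply: (@steady_chain _ _ X) q0'.
  + move=> i; rewrite /X; case: ifP => _.
      by have [/gold_den0] := gold_fibv i G.
    by have [/gold_den0] := gold_fibv (i - k) Gb.
  + move=> n; have [j hj] := fibv_den_large n Gb.
    by exists (j + k)%N; rewrite XG ?leq_addl // addnK.
  + move=> eta eta0; have [j hj] := fibv_res_small Gb eta0.
    by exists (j + k)%N; rewrite XG ?leq_addl // addnK.
  + move=> i x; have [ki|ik] := leqP k i.
      rewrite !XG ?(leq_trans ki) // subSn //.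
      exact: gold_gap Gb smallb.
    rewrite XS // => hx; rewrite /X ik.
    have [Gi hEi] := gold_fibv i G.
    move: ik; rewrite leq_eqVlt => /orP[/eqP ik|ik].
      have vE : fibv v0 v1 i.+1 = v by rewrite ik.
      have bi : res beta (fibv v0 v1 i) <= 17 / 10 * res alpha v + 5 / 4 * res alpha v.
        have di := gold_den0 Gi.
        apply: le_trans (res_perturb alpha beta (ltW di)) _; apply: lerD.
          by rewrite (gold_res Gi) vE ler_wpM2r // ltW.
        apply: le_trans hd; rewrite ler_wpM2r //; first exact: dist_ge0.
        by rewrite ler_int -vE; exact: gold_den1 Gi.
      have hx' : 0 < den x <= den w.
        by rewrite vE in hx; have := gold_den1 Gb; case/andP: hx => -> /le_trans; apply.
      have [near|far] := gold_near Gb hx'.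
        have rw := res_ge0 beta w.
        have : res beta v <= 2 * res beta w.
          by rewrite (gold_res Gb) ler_wpM2r //; clear -f2; lra.
        by clear -near b1 bi eps0; lra.
      have rx := res_ge0 beta x.
      have h8 : height beta v w * res alpha v * res beta x <= 4 * res beta x.
        by rewrite ler_wpM2r.
      have : res alpha v * 1 <= res alpha v * (2 * height beta v w * res beta x).
        by rewrite ler_pM2l.
      by clear -h8 bi eps0; lra.
    apply: (turn_gap Gi _ eps0 _ _ hx).
    * rewrite hEi; apply: le_trans small; rewrite ler_pM2l; last exact: mulr_gt0.
      exact: (fibv_res_mono (i := 0) G).
    * have [Gk' _] := gold_fibv k.-1 G; have := gold_res Gk'.
      rewrite prednK; last by apply: leq_ltn_trans ik.
      rewrite -/v => <-; apply: fibv_res_mono G _.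
      by rewrite -ltnS prednK //; apply: leq_ltn_trans ik.
    * apply: le_trans hd; rewrite ler_wpM2r //; first exact: dist_ge0.
      by rewrite ler_int; apply: fibv_den_mono G _; exact: ltnW.
- by clear -hdist e1 eps0; lra.
- by move=> e; move: b2; rewrite e; clear -eps0; lra.
- move=> l /(gold_on_line Gk)[h1 h2] /(gold_on_line Gb)[_ h3].
  apply: (eq0_of_dot0 Gk) => //; move: h3.
  have -> : dot l w = dot l u + m * dot l v by rewrite wE /dot /=; ring.
  by rewrite h1 mulr0 addr0.
Qed.

(** The point (1 / phi, 0), for which the Fibonacci chain starts at q = 1. *)
Lemma tame_exists (R : realType) : exists alpha : R * R, tame alpha.
Proof.
have fE := phi_sqr R; have [f1 f2] := phi_bounds R.
pose alpha : R * R := (phi R - 1, 0).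
pose v0 : vec := (1, 0, 0); pose v1 : vec := (1, 1, 0).
have G : gold alpha (0, 0, 1) v0 v1.
  split => //.
    rewrite /err1 /=; move: fE; rewrite !mul1r; clear; lra.
  by rewrite /err2 /= !mulr0 subrr mulr0.
exists alpha; split; first by exists (0, 0, 1), v0, v1.
have r0 : res alpha v0 = phi R - 1.
  rewrite /res /err1 /err2 /= mul1r mulr0 !subr0 normr0.
  by rewrite max_l ?normr_ge0 // ger0_norm //; lra.
have H1 : height alpha v0 v1 = 1.
  have e := gold_res G; rewrite r0 in e.
  apply: (mulfI (lt0r_neq0 (phi_gt0 R))).
  rewrite /height mulrCA -e (_ : den v0 = 1) // (_ : den v1 = 1) //.
  by clear -fE; lra.
move=> q q0; apply: (gold_steady G); first by rewrite H1 r0; lra.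
by rewrite /den /= lez_nat.
Qed.

(** * Nested squares *)

Lemma nested_intervals (R : realType) (l r : nat -> R) :
  (forall n, l n <= l n.+1) -> (forall n, r n.+1 <= r n) -> (forall n, l n <= r n) ->
  exists x, forall n, l n <= x <= r n.
Proof.
move=> hl hr hlr.
have lm : {homo l : m n / (m <= n)%N >-> m <= n}.
  by apply: homo_leq => // a b c; exact: le_trans.
have rm : {homo r : m n / (m <= n)%N >-> n <= m}.
  by apply: homo_leq => // a b c h1 h2; exact: le_trans h2 h1.
have lr m n : l m <= r n.
  apply: le_trans (lm _ _ (leq_maxl m n)) _; apply: le_trans (hlr _) _.
  exact: rm _ _ (leq_maxr m n).
exists (sup (range l)) => n; apply/andP; split.
  by apply: ub_le_sup; [exists (r 0%N) => _ [m _ <-] | exists n].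
by apply: ge_sup; [exists (l 0%N), 0%N | move=> _ [m _ <-]].
Qed.

(** Baire's argument relative to a subset A, which need not be closed: the limit
    of the nested squares may leave A. *)
Lemma dense_open_intersection (R : realType) (A : R * R -> Prop) (P : nat -> R * R -> Prop) :
  (exists alpha, A alpha) ->
  (forall n alpha, P n alpha -> nearby alpha (P n)) ->
  (forall n alpha d, A alpha -> 0 < d ->
     exists beta, [/\ A beta, dist alpha beta <= d & P n beta]) ->
  exists alpha, forall n, P n alpha.
Proof.
move=> [a0 A0] open dense.
pose state := (R * R * R)%type.
pose good (s : state) := A s.1 /\ 0 < s.2.
have step_ex (ns : nat * state) : exists s' : state, good ns.2 ->
    [/\ good s', dist ns.2.1 s'.1 <= ns.2.2 / 2, s'.2 <= ns.2.2 / 2 &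
        forall beta, dist s'.1 beta <= s'.2 -> P ns.1 beta].
  case: ns => n s; have [[As s0]|nb] := pselect (good s); last by exists s.
  have s2 : 0 < s.2 / 2 by rewrite divr_gt0.
  have [b [Ab db Pb]] := dense n _ _ As s2; have [e e0 he] := open _ _ Pb.
  exists (b, Num.min (s.2 / 2) e) => _; split => //=.
  - by split => //=; rewrite lt_min s2.
  - by rewrite ge_min lexx.
  - by move=> beta; rewrite le_min => /andP[_ /he].
have [f fP] := choice step_ex.
pose s := fix s n := if n is m.+1 then f (m, s m) else (a0, 1) : state.
have sg n : good (s n).
  elim: n => [|n IH]; first by split => //=; exact: ltr01.
  by have [] := fP (n, s n) IH.
have sS n : [/\ good (s n.+1), dist (s n).1 (s n.+1).1 <= (s n).2 / 2,
    (s n.+1).2 <= (s n).2 / 2 & forall beta, dist (s n.+1).1 beta <= (s n.+1).2 -> P n beta].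
  exact: fP (n, s n) (sg n).
have coord n : `|(s n.+1).1.1 - (s n).1.1| <= (s n).2 / 2 /\
    `|(s n.+1).1.2 - (s n).1.2| <= (s n).2 / 2.
  by have [_] := sS n; rewrite /dist ge_max => /andP[].
have [x hx] : exists x, forall n, (s n).1.1 - (s n).2 <= x <= (s n).1.1 + (s n).2.
  apply: nested_intervals => n.
  - have [/ler_normlP[c1 c2] _] := coord n; have [_ _ h _] := sS n; lra.
  - have [/ler_normlP[c1 c2] _] := coord n; have [_ _ h _] := sS n; lra.
  - have [_ h] := sg n; lra.
have [y hy] : exists y, forall n, (s n).1.2 - (s n).2 <= y <= (s n).1.2 + (s n).2.
  apply: nested_intervals => n.
  - have [_ /ler_normlP[c1 c2]] := coord n; have [_ _ h _] := sS n; lra.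
  - have [_ /ler_normlP[c1 c2]] := coord n; have [_ _ h _] := sS n; lra.
  - have [_ h] := sg n; lra.
exists (x, y) => n; have [_ _ _] := sS n; apply.
rewrite /dist ge_max /= !ler_distl.
by apply/andP; split; [exact: (hx n.+1) | exact: (hy n.+1)].
Qed.

(** * The remaining open conditions *)

(** q * error^2 is at most height * error, which tends to 0 along the Fibonacci
    points. *)
Lemma gold_well_approximable (R : realType) (alpha : R * R) (u v0 v1 : vec) (t : R) :
  gold alpha u v0 v1 -> 0 < t ->
  exists2 q, (0 < q)%N & Num.sqrt q%:R * approx_err alpha q < t.
Proof.
move=> G t0; have [H0 _] := gold_height_gt0 G.
have tH : 0 < t * t / height alpha v0 v1 by apply: divr_gt0 => //; exact: mulr_gt0.
have [j] := fibv_res_small G tH; rewrite ltr_pdivlMr // => hj.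
have [G' hE] := gold_fibv j G; have := gold_den_res G'; rewrite hE => hq.
have q0 := gold_den0 G'.
exists `|den (fibv v0 v1 j)|%N; first by rewrite absz_gt0 gt_eqF.
have e : approx_err alpha `|den (fibv v0 v1 j)| <= res alpha (fibv v0 v1 j).
  by apply: approx_err_le_res; rewrite gez0_abs // ltW.
have qE : `|den (fibv v0 v1 j)|%N%:R = (den (fibv v0 v1 j))%:~R :> R.
  by rewrite pmulrn gez0_abs // ltW.
apply: le_lt_trans (ler_wpM2l (sqrtr_ge0 _) e) _.
have sq : Num.sqrt (`|den (fibv v0 v1 j)|%N%:R : R) ^+ 2 = (den (fibv v0 v1 j))%:~R.
  by rewrite sqr_sqrtr // qE.
have r0 := res_ge0 alpha (fibv v0 v1 j).
have s0 := sqrtr_ge0 (`|den (fibv v0 v1 j)|%N%:R : R).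
rewrite -(ltr_pXn2r (n := 2)) ?nnegrE ?mulr_ge0 ?(ltW t0) //.
rewrite exprMn sq expr2 mulrA; apply: le_lt_trans (ler_wpM2r r0 hq) _.
by rewrite mulrC.
Qed.

Lemma nearby_off_line (R : realType) (alpha : R * R) (l : vec) :
  ~ on_line alpha l -> nearby alpha (fun beta => ~ on_line beta l).
Proof.
rewrite /on_line => h; set s := _ + _ in h; have s0 : 0 < `|s| by rewrite normr_gt0; apply/eqP.
pose c : R := `|l.1.2%:~R| + `|l.2%:~R|.
have c1 : 0 < c + 1 by rewrite ltr_wpDl // addr_ge0.
have h2 : 0 < `|s| / 2 by rewrite divr_gt0.
exists (`|s| / 2 / (c + 1)); first by rewrite divr_gt0.
move=> beta; rewrite ler_pdivlMr // => hd e.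
have d0 := dist_ge0 alpha beta.
have [d1 d2] := coord_le_dist alpha beta.
have : `|s| <= c * dist alpha beta.
  rewrite -normrN [- s](_ : _ = l.1.2%:~R * (beta.1 - alpha.1) + l.2%:~R * (beta.2 - alpha.2)).
    apply: le_trans (ler_normD _ _) _.
    by rewrite !normrM /c mulrDl lerD // ler_wpM2l.
  by rewrite -[LHS]addr0 -[X in _ + X]e /s; ring.
clear -s0 hd d0; lra.
Qed.

Lemma nearby_neq (R : realType) (alpha e : R * R) :
  alpha <> e -> nearby alpha (fun beta => beta <> e).
Proof.
move=> ne; exists (dist alpha e / 2).
  rewrite divr_gt0 // /dist lt_max !normr_gt0 !subr_eq0 -negb_and.
  apply/negP => /andP[/eqP e1 /eqP e2]; apply: ne.
  by rewrite [LHS]surjective_pairing -e1 -e2 -surjective_pairing.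
move=> beta hd eb; rewrite eb in hd.
have d0 := dist_ge0 alpha e.
have : dist alpha e = 0 by clear -hd d0; lra.
move=> /eqP; rewrite eq_le d0 andbT /dist ge_max !normr_le0 !subr_eq0 => /andP[/eqP e1 /eqP e2].
by apply: ne; rewrite [LHS]surjective_pairing -e1 -e2 -surjective_pairing.
Qed.

(** * Uncountability *)

Theorem theorem2 (R : realType) :
  ~ countable [set alpha : R * R |
      [/\ Zindependent1 alpha,
          exists q : nat -> nat, best_approx_seq alpha q /\
            0 < inf [set approx_err alpha (q nu.+1) / approx_err alpha (q nu)
                    | nu in [set: nat]]
        & ~ badly_approximable alpha]].
Proof.
set A := [set _ | _]; move=> /countable_injP[f finj].
(* e n is the only point of A that can have code n, if there is one. *)
have pt_ex n : exists e, forall alpha, A alpha -> f alpha = n -> alpha = e.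
  have [[e [Ae fe]]|no] := pselect (exists e, A e /\ f e = n).
    by exists e => alpha Aa fa; apply: finj; rewrite ?inE // fe.
  by exists (0, 0) => alpha Aa fa; case: no; exists alpha.
have [e eP] := choice pt_ex.
pose line n : vec := odflt (0, 0, 0) (unpickle n).
pose P n alpha := [/\ steady alpha n.+1,
  exists2 q, (0 < q)%N & Num.sqrt q%:R * approx_err alpha q < n.+1%:R^-1,
  line n <> (0, 0, 0) -> ~ on_line alpha (line n) & alpha <> e n].
have Popen n alpha : P n alpha -> nearby alpha (P n).
  move=> [p1 [q q0 p2] p3 p4].
  have n1 := nearby_steady p1; have n4 := nearby_neq p4.
  have p2' : Num.sqrt q%:R * approx_err alpha q < 0 * approx_err alpha 0 + n.+1%:R^-1.
    by rewrite mul0r add0r.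
  have n2 := nearby_err_lt (sqrtr_ge0 _) (lexx 0) p2'.
  have n3 : nearby alpha (fun beta => line n <> (0, 0, 0) -> ~ on_line beta (line n)).
    have [z|nz] := pselect (line n = (0, 0, 0)); first by exists 1.
    by have [d d0 hd] := nearby_off_line (p3 nz); exists d => // beta /hd.
  have [d d0 hd] := nearby_and (nearby_and n1 n2) (nearby_and n3 n4).
  exists d => // beta /hd[[h1 h2] [h3 h4]]; split => //.
  by exists q => //; move: h2; rewrite mul0r add0r.
have Pdense n alpha d : tame alpha -> 0 < d ->
    exists beta, [/\ tame beta, dist alpha beta <= d & P n beta].
  move=> ta d0.
  have n3 : nearby alpha (fun beta => ~ on_line alpha (line n) -> ~ on_line beta (line n)).
    have [z|nz] := pselect (on_line alpha (line n)); first by exists 1.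
    by have [d' d'0 hd] := nearby_off_line nz; exists d' => // beta /hd.
  have n4 : nearby alpha (fun beta => alpha <> e n -> beta <> e n).
    have [z|nz] := pselect (alpha = e n); first by exists 1.
    by have [d' d'0 hd] := nearby_neq nz; exists d' => // beta /hd.
  have [d' d'0 hd] := nearby_and n3 n4.
  have m0 : 0 < Num.min d d' by rewrite lt_min d0.
  have [beta [tb db nb lb]] := tame_step ta m0.
  move: db; rewrite le_min => /andP[db /hd[h3 h4]].
  exists beta; split => //; split.
  - by case: tb => _; apply.
  - case: tb => [[u [v0 [v1 G]]] _]; apply: gold_well_approximable G _.
    by rewrite invr_gt0.
  - move=> nz; have [ra|/h3 //] := pselect (on_line alpha (line n)).
    by move=> rb; apply: nz; exact: lb ra rb.
  - have [ea|/h4 //] := pselect (alpha = e n).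
    by rewrite -ea.
have [alpha aP] := dense_open_intersection (tame_exists R) Popen Pdense.
suff Aa : A alpha.
  by have [_ _ _] := aP (f alpha); apply; exact: eP.
split.
- move=> a b c h.
  have [] := aP (pickle (a, b, c)); rewrite /line pickleK /= => _ _ nr _.
  have [[-> -> ->] //|nz] := pselect ((a, b, c) = (0, 0, 0)).
  by case: (nr nz).
- apply: steady_ratio => -[//|n _]; by case: (aP n).
- rewrite /badly_approximable; set i := inf _ => i0.
  have hi q : (0 < q)%N -> i <= Num.sqrt q%:R * approx_err alpha q.
    move=> q0; apply: ge_inf; last by exists q.
    by exists 0 => _ [p _ <-]; rewrite mulr_ge0 ?sqrtr_ge0 ?approx_err_ge0.
  pose n := Num.bound i^-1.
  have [_ [q q0 lt] _ _] := aP n.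
  have hn : i^-1 < n%:R by apply: archi_boundP; rewrite invr_ge0 ltW.
  have : n.+1%:R^-1 < i.
    rewrite -[ltRHS]invrK ltf_pV2 ?posrE ?invr_gt0 //.
    by apply: lt_le_trans hn _; rewrite ler_nat.
  by move=> /(lt_trans lt); rewrite ltNge hi.
Qed.
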